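(* (Conservation of mass of the single pipe model.) Let $\alpha,\beta,\kappa,\gamma\in\mathbb R$ with $\alpha\neq0$, $\beta\ne0$, and consider the system $\dot x=Ax+Bu$ with state and output $x=\begin{bmatrix}p_r&q_\ell\end{bmatrix}^\top$, input $u=\begin{bmatrix}p_\ell&q_r\end{bmatrix}^\top$ and $$A=\begin{bmatrix}0&-\alpha\\ \beta&\gamma\end{bmatrix},\qquad B=\begin{bmatrix}0&\alpha\\ \kappa&0\end{bmatrix}.$$ Then the DC gain from $u$ to $x$ is $$-A^{-1}B=\begin{bmatrix}-\kappa/\beta&-\gamma/\beta\\ 0&1\end{bmatrix},$$ and consequently the model satisfies conservation of mass: its transfer function $T(s)=(sI-A)^{-1}B=\begin{bmatrix}T_{pp}(s)&T_{pq}(s) \\ {T_{qp}(s)}&T_{qq}(s)\end{bmatrix}$ satisfies $T_{qp}(0)=0$ and $T_{qq}(0)=1$.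
   Context: $p_\ell,p_r$ are pressures and $q_\ell,q_r$ mass flows (deviations from nominal values) at the left and right ends of a pipe. The coefficients are real constants; in the application $\alpha=-\frac{R_sT_0z_0}{AX}$ and $\beta=-\frac{A}{X}$ with all physical parameters positive (here $A$ is the cross-sectional area), so $\alpha,\beta\neq0$. The DC gain is the value of the transfer function at $s=0$. *)

(* Defs.v *)
From HB Require Import structures.
From mathcomp Require Import all_boot all_order all_algebra.
From mathcomp Require Import reals.
From mathcomp Require Import complex.

Set Implicit Arguments.
Unset Strict Implicit.
Unset Printing Implicit Defensive.

Import GRing.Theory.
Local Open Scope ring_scope.

Definition mx2 (R : Type) (a b c d : R) : 'M[R]_2 :=
  \matrix_(i < 2, j < 2)
    if i == 0 then (if j == 0 then a else b) else (if j == 0 then c else d).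

(* For x' = A x + B u with output x, this is s |-> (s I - A)^-1 B, where s is
   complex and A, B are real.  When s is an eigenvalue of A, [invmx] returns its
   argument, so the value there is meaningless. *)
Definition transfer_function (R : realType) (n m : nat)
    (A : 'M[R]_n) (B : 'M[R]_(n, m)) (s : R[i]) : 'M[R[i]]_(n, m) :=
  invmx (s%:M - map_mx (real_complex R) A) *m map_mx (real_complex R) B.

Definition dc_gain (R : realType) (n m : nat)
    (A : 'M[R]_n) (B : 'M[R]_(n, m)) : 'M[R[i]]_(n, m) :=
  transfer_function A B 0.

(* State and output x = (p_r, q_l), input u = (p_l, q_r): index 0 is the
   pressure and index 1 the mass flow, both for rows and for columns. *)
Definition pipe_A (R : realType) (alpha beta gamma : R) : 'M[R]_2 :=
  mx2 0    (- alpha)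
      beta gamma.

Definition pipe_B (R : realType) (alpha kappa : R) : 'M[R]_2 :=
  mx2 0     alpha
      kappa 0.

(* T_qp(0) = 0 and T_qq(0) = 1. *)
Definition conserves_mass (R : realType) (T : R[i] -> 'M[R[i]]_2) : Prop :=
  T 0 1 0 = 0 /\ T 0 1 1 = 1.

(* Main.v *)
Require Import Defs.
From HB Require Import structures.
From mathcomp Require Import all_boot all_order all_algebra.
From mathcomp Require Import reals.
From mathcomp Require Import complex.
From mathcomp Require Import ring.

Set Implicit Arguments.
Unset Strict Implicit.
Unset Printing Implicit Defensive.

Import GRing.Theory.
Local Open Scope ring_scope.

(** The determinant of [A] is [alpha * beta], which is nonzero, so 0 is not an eigenvalue and the
    transfer function at 0 is truly [- invmx A *m B] ([dc_gain_unitmx]). The claimed gain G is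
    checked rather than computed: [A *m G = - B] ([pipe_A_mul_gain]), and cancelling [A] identifies
    G. Mass conservation is the second row of G. *)

Lemma invmxN (F : comUnitRingType) (n : nat) (A : 'M[F]_n) :
  A \in unitmx -> invmx (- A) = - invmx A.
Proof.
move=> Au; rewrite -!scaleN1r invmxZ ?invrN1 //.
by rewrite unitmxZ ?unitrN1.
Qed.

(** At [s = 0] the matrix to invert is the complex image of [- A]; embedding the reals commutes with
    inverses and products. *)
Lemma dc_gain_unitmx (R : realType) (n m : nat)
    (A : 'M[R]_n) (B : 'M[R]_(n, m)) :
  A \in unitmx -> dc_gain A B = map_mx (real_complex R) (- invmx A *m B).
Proof.
move=> Au; rewrite /dc_gain /transfer_function raddf0 sub0r.
by rewrite invmxN ?map_unitmx // -map_invmx -map_mxN -map_mxM.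
Qed.

Lemma pipe_A_unitmx (R : realType) (alpha beta gamma : R) :
  alpha != 0 -> beta != 0 -> pipe_A alpha beta gamma \in unitmx.
Proof.
move=> a0 b0; rewrite unitmxE (expand_det_row _ 0) !big_ord_recl big_ord0.
(* Along the first row only [- alpha] survives, with cofactor [- beta]. *)
rewrite /cofactor !det_mx11 !mxE /= mul0r add0r addr0 expr1 mulN1r mulrNN.
by rewrite unitfE mulf_neq0.
Qed.

Lemma pipe_A_mul_gain (R : realType) (alpha beta kappa gamma : R) :
  beta != 0 ->
  pipe_A alpha beta gamma *m mx2 (- kappa / beta) (- gamma / beta) 0 1
  = - pipe_B alpha kappa.
Proof.
move=> b0; apply/matrixP => i j.
rewrite !mxE !big_ord_recl big_ord0 !mxE /=.
by case: (i == 0); case: (j == 0); field.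
Qed.

Theorem mainTheorem6 (R : realType) (alpha beta kappa gamma : R)
    (alpha_neq0 : alpha != 0) (beta_neq0 : beta != 0) :
  let A := pipe_A alpha beta gamma in
  let B := pipe_B alpha kappa in
  [/\ A \in unitmx,
      dc_gain A B = map_mx (real_complex R) (- invmx A *m B),
      - invmx A *m B = mx2 (- kappa / beta) (- gamma / beta)
                           0                1
    & conserves_mass (transfer_function A B)].
Proof.
move=> A B.
have Au : A \in unitmx by apply: pipe_A_unitmx.
have dcE := dc_gain_unitmx B Au.
have gainE : - invmx A *m B = mx2 (- kappa / beta) (- gamma / beta) 0 1.
  (* Move the sign onto [B], replace [- B] by [A *m G], and cancel [A]. *)
  by rewrite mulNmx -mulmxN -(pipe_A_mul_gain alpha kappa gamma beta_neq0) mulKmx.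
(* Both entries are read off the second row of the real gain. *)
split=> //; rewrite /conserves_mass -/(dc_gain A B) dcE gainE !mxE /=.
by rewrite rmorph0 rmorph1.
Qed.
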